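(* Let $n$ be a natural number, let $a_1,\dots,a_n$ be natural numbers (positive integers), and let $b$ be a non-negative integer. Let $$s_1=\left\lfloor\frac{\sum_{i=1}^{n}a_i}{2}\right\rfloor,\qquad s_2=\left\lfloor\frac{\sum_{i=1}^{n}a_i-1}{2}\right\rfloor,$$ and for a non-negative integer $d$ let $P^{*}(d)$ be the number of integer solutions $(t_1,\dots,t_n)$ of the system $$\sum_{i=1}^{n}a_it_i=d,\qquad 0\le t_i\le 1\quad(i=1,2,\dots,n).$$ Then $$P(b)=\begin{cases}\displaystyle\sum_{k=0}^{s_1}P^{*}(2k)\,P\Bigl(\frac{b}{2}-k\Bigr)&\text{if } b\text{ is even},\\[2ex]\displaystyle\sum_{k=0}^{s_2}P^{*}(2k+1)\,P\Bigl(\left\lfloor\frac{b}{2}\right\rfloor-k\Bigr)&\text{if } b\text{ is odd}.\end{cases}$$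
   Context: For an integer $l$, $P(l)$ denotes the number of $n$-tuples $(x_1,\dots,x_n)$ of non-negative integers with $\sum_{i=1}^n a_ix_i=l$ (so $P(l)=0$ for $l<0$). *)

(* Defs.v *)
From HB Require Import structures.
From mathcomp Require Import all_boot all_order all_algebra finmap.
From mathcomp Require Import boolp classical_sets functions cardinality.
Set Implicit Arguments.
Unset Strict Implicit.
Unset Printing Implicit Defensive.
Import Order.TTheory GRing.Theory Num.Theory.
Local Open Scope classical_set_scope.
Local Open Scope ring_scope.

Definition solutions (n : nat) (a : 'I_n -> nat) (l : int) : set (n.-tuple nat) :=
  [set x | \sum_(i < n) (a i)%:Z * (tnth x i)%:Z = l].

Definition solutions01 (n : nat) (a : 'I_n -> nat) (d : nat) : set (n.-tuple int) :=
  [set t | \sum_(i < n) (a i)%:Z * tnth t i = d%:Z /\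
           forall i : 'I_n, 0 <= tnth t i <= 1].

(* [fset_set] is the empty set on infinite sets; the two finiteness lemmas below
   show that this default is never used when the coefficients are positive. *)
Definition P (n : nat) (a : 'I_n -> nat) (l : int) : nat :=
  #|` fset_set (solutions a l)|%fset.

Definition Pstar (n : nat) (a : 'I_n -> nat) (d : nat) : nat :=
  #|` fset_set (solutions01 a d)|%fset.

Lemma finite_solutions (n : nat) (a : 'I_n -> nat) (l : int) :
  (forall i, (0 < a i)%N) -> finite_set (solutions a l).
Proof.
move=> a_gt0; pose m := `|l|%N.
pose f (g : {ffun 'I_n -> 'I_m.+1}) : n.-tuple nat := [tuple val (g i) | i < n].
apply: (@sub_finite_set _ _ (f @` setT)); last exact/finite_image/finite_finset.
move=> x xl; exists [ffun i => inord (tnth x i)] => //.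
apply: eq_from_tnth => i; rewrite tnth_mktuple ffunE /= inordK // ltnS /m.
have -> : l = (\sum_(j < n) a j * tnth x j)%N%:Z.
  by rewrite -xl (big_morph Posz PoszD (erefl 0%:Z)).
by rewrite absz_nat (bigD1 i) //= (leq_trans _ (leq_addr _ _)) // leq_pmull.
Qed.

Lemma finite_solutions01 (n : nat) (a : 'I_n -> nat) (d : nat) :
  finite_set (solutions01 a d).
Proof.
pose f (g : {ffun 'I_n -> bool}) : n.-tuple int := [tuple (g i : nat)%:Z | i < n].
apply: (@sub_finite_set _ _ (f @` setT)); last exact/finite_image/finite_finset.
move=> t [_ t01]; exists [ffun i => tnth t i == 1] => //.
apply: eq_from_tnth => i; rewrite tnth_mktuple ffunE /=.
by have := t01 i; case: (tnth t i) => [[|[|k]]|k].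
Qed.

(* Main.v *)
Require Import Defs.
From HB Require Import structures.
From mathcomp Require Import all_boot all_order all_algebra finmap.
From mathcomp Require Import boolp classical_sets functions cardinality.
From mathcomp Require Import zify.
Set Implicit Arguments.
Unset Strict Implicit.
Unset Printing Implicit Defensive.
Import Order.TTheory GRing.Theory Num.Theory.
Local Open Scope ring_scope.

(** Every tuple x of non-negative integers is uniquely x = 2 y + t, where t is
    the 0-1 indicator of the set e of indices at which x is odd.  Writing w(e)
    for the sum of the a_i over e, x solves the equation for b if and only if
    b = w(e) + 2 sum a_i y_i; this forces w(e) and b to have the same parity, and
    then y solves the equation for floor(b/2) - floor(w(e)/2)
    ([solutions_with_odd_support]).  Hence P(b) is the sum, over the sets e with
    w(e) of the parity of b, of P(floor(b/2) - floor(w(e)/2))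
    ([P_sum_odd_support]).  Since P*(d) counts the sets e of weight d
    ([Pstar_card_weight]), grouping the sets e by k = floor(w(e)/2) gives both
    cases at once, with d = 2 k or d = 2 k + 1; the ranges of k in the two cases
    only have to contain every floor(w(e)/2), and w(e) is at most the sum of all
    the a_i ([P_sum_Pstar]). *)

Definition weight (n : nat) (a : 'I_n -> nat) (e : {set 'I_n}) : nat :=
  (\sum_(i in e) a i)%N.

Definition odd_support (n : nat) (x : n.-tuple nat) : {set 'I_n} :=
  [set i | odd (tnth x i)].

Lemma solutionsE (n : nat) (a : 'I_n -> nat) (l : int) (x : n.-tuple nat) :
  solutions a l x <-> (\sum_(i < n) a i * tnth x i)%N%:Z = l.
Proof.
by rewrite /solutions /= (big_morph Posz PoszD (erefl 0%:Z)).
Qed.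

(** The inverse of the decomposition of a tuple into its halves and its parities. *)
Definition double_plus (n : nat) (e : {set 'I_n}) (y : n.-tuple nat) :
    n.-tuple nat :=
  [tuple ((i \in e) + (tnth y i).*2)%N | i < n].

Lemma double_plus_inj (n : nat) (e : {set 'I_n}) : injective (double_plus e).
Proof.
move=> y z yz; apply: eq_from_tnth => i.
have /(congr1 (fun t => tnth t i)) := yz.
by rewrite !tnth_mktuple => /addnI/double_inj.
Qed.

Lemma odd_support_double_plus (n : nat) (e : {set 'I_n}) (y : n.-tuple nat) :
  odd_support (double_plus e y) = e.
Proof.
by apply/setP => i; rewrite inE tnth_mktuple oddD odd_double addbF oddb.
Qed.

Lemma double_plus_half (n : nat) (x : n.-tuple nat) :
  double_plus (odd_support x) [tuple (tnth x i)./2 | i < n] = x.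
Proof.
by apply: eq_from_tnth => i; rewrite !tnth_mktuple inE odd_double_half.
Qed.

Lemma sum_double_plus (n : nat) (a : 'I_n -> nat) (e : {set 'I_n})
    (y : n.-tuple nat) :
  (\sum_(i < n) a i * tnth (double_plus e y) i =
   weight a e + (\sum_(i < n) a i * tnth y i).*2)%N.
Proof.
rewrite /weight [in RHS]big_mkcond /= -muln2 big_distrl -big_split /=.
by apply: eq_bigr => i _; rewrite tnth_mktuple; case: (i \in e); lia.
Qed.

(** Once e is fixed, halving x is a bijection onto the solutions for
    (b - w(e)) / 2, which is floor(b/2) - floor(w(e)/2) when the parities agree;
    the equation for b has no such x when they differ.  If w(e) > b, both
    counts are zero, since the halved argument is negative. *)
Lemma solutions_with_odd_support (n : nat) (a : 'I_n -> nat)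
    (a_gt0 : forall i, (0 < a i)%N) (b : nat) (e : {set 'I_n}) :
  #|` [fset x in fset_set (solutions a b%:Z) | odd_support x == e]|%fset =
  if odd (weight a e) == odd b
  then P a ((b %/ 2)%N%:Z - (weight a e)./2%:Z) else 0%N.
Proof.
have [wb|wb] := eqVneq (odd (weight a e)) (odd b); last first.
  apply/eqP; rewrite cardfs_eq0; apply/eqP/fsetP => x; rewrite !inE /=.
  apply/negP => /andP[+ /eqP xe].
  rewrite in_fset_set ?inE; last exact: finite_solutions.
  move/solutionsE => [xb]; move/eqP: wb; apply.
  by rewrite -xb -[in RHS](double_plus_half x) sum_double_plus xe oddD
    odd_double addbF.
set S := fset_set (solutions a ((b %/ 2)%N%:Z - (weight a e)./2%:Z)).
have -> : P a ((b %/ 2)%N%:Z - (weight a e)./2%:Z) =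
    #|` [fset double_plus e y | y in S]|%fset.
  by rewrite card_imfset //; apply: double_plus_inj.
congr #|` _|%fset; apply/fsetP => x; rewrite !inE /=.
have inS l y : (y \in fset_set (solutions a l)) <->
    (\sum_(i < n) a i * tnth y i)%N%:Z = l.
  rewrite in_fset_set ?inE; last exact: finite_solutions.
  exact: solutionsE.
apply/andP/imfsetP => [[/inS xb /eqP xe]|[y /inS yl ->]].
  exists [tuple (tnth x i)./2 | i < n]; last by rewrite -xe double_plus_half.
  apply/inS; move: xb.
  rewrite -[in X in X -> _](double_plus_half x) sum_double_plus xe.
  set s := (\sum_(i < n) _)%N => xb; lia.
split; last by rewrite odd_support_double_plus.
apply/inS; rewrite sum_double_plus.
move: yl; set s := (\sum_(i < n) _)%N => yl; lia.
Qed.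

Lemma P_sum_odd_support (n : nat) (a : 'I_n -> nat)
    (a_gt0 : forall i, (0 < a i)%N) (b : nat) :
  P a b%:Z = (\sum_(e : {set 'I_n} | odd (weight a e) == odd b)
                P a ((b %/ 2)%N%:Z - (weight a e)./2%:Z))%N.
Proof.
rewrite [LHS]/P card_fset_sum1 (partition_big (@odd_support n) xpredT) //=.
rewrite [RHS]big_mkcond; apply: eq_bigr => e _.
by rewrite -(solutions_with_odd_support a_gt0) card_fset_sum1 big_fset_condE.
Qed.

(** A 0-1 solution is the indicator of the set of indices where it is 1. *)
Lemma Pstar_card_weight (n : nat) (a : 'I_n -> nat) (d : nat) :
  Pstar a d = #|[set e : {set 'I_n} | weight a e == d]|.
Proof.
pose f (e : {set 'I_n}) : n.-tuple int := [tuple (i \in e : nat)%:Z | i < n].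
have f_inj : injective f.
  move=> e e' /(congr1 (fun t => tnth t _)) ee'; apply/setP => i.
  by have := ee' i; rewrite !tnth_mktuple; do 2!case: (i \in _).
have sum_f e : \sum_(i < n) (a i)%:Z * tnth (f e) i = (weight a e)%:Z.
  rewrite /weight (big_morph Posz PoszD (erefl 0%:Z)) [RHS]big_mkcond /=.
  by apply: eq_bigr => i _; rewrite tnth_mktuple; case: (i \in e); lia.
have -> : Pstar a d =
    #|` [fset f e | e in [set e : {set 'I_n} | weight a e == d]]|%fset.
  congr #|` _|%fset; apply/fsetP => t.
  rewrite in_fset_set ?inE; last exact: finite_solutions01.
  apply/idP/imfsetP => /= [/asboolP[td t01]|[e + ->]].
    have tE : t = f [set i | tnth t i == 1].
      apply: eq_from_tnth => i; rewrite tnth_mktuple inE.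
      by have := t01 i; case: (tnth t i) => [[|[|k]]|k].
    exists [set i | tnth t i == 1] => //.
    by rewrite inE -eqz_nat -sum_f -tE td.
  rewrite finset.in_set => /eqP we; apply/asboolP; split; first by rewrite sum_f we.
  by move=> i; rewrite tnth_mktuple; case: (i \in e).
by rewrite card_imfset // -cardE.
Qed.

(** The bound s is left free so that both parities of b share this proof: the
    odd case may use a smaller s because an odd weight loses 1 when halved. *)
Lemma P_sum_Pstar (n : nat) (a : 'I_n -> nat)
    (a_gt0 : forall i, (0 < a i)%N) (b s : nat) :
  (forall e : {set 'I_n}, odd (weight a e) = odd b -> ((weight a e)./2 <= s)%N) ->
  P a b%:Z = (\sum_(0 <= k < s.+1)
                Pstar a (2 * k + odd b) * P a ((b %/ 2)%N%:Z - k%:Z)%R)%N.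
Proof.
move=> ws; rewrite (P_sum_odd_support a_gt0) big_mkord.
rewrite (partition_big (fun e => inord (weight a e)./2 : 'I_s.+1) xpredT) //=.
apply: eq_bigr => k _; rewrite Pstar_card_weight -sum_nat_const.
apply: congr_big => // [e|e /andP[/eqP/ws wle /eqP <-]]; last by rewrite inordK.
rewrite inE -val_eqE /=; have := ws e; case: eqP => [we /(_ we) wle|we _] /=.
  by rewrite inordK //; apply/eqP/eqP; lia.
by symmetry; apply/eqP; lia.
Qed.

Lemma weight_le_sum (n : nat) (a : 'I_n -> nat) (e : {set 'I_n}) :
  (weight a e <= \sum_(i < n) a i)%N.
Proof. by rewrite /weight [leqRHS](bigID (mem e)) leq_addr. Qed.

Theorem corollary4p4 (n : nat) (hn : (0 < n)%N) (a : 'I_n -> nat)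
    (ha : forall i : 'I_n, (0 < a i)%N) (b : nat) :
  let s1 := ((\sum_(i < n) a i) %/ 2)%N in
  let s2 := ((\sum_(i < n) a i - 1) %/ 2)%N in
  P a b%:Z =
    if ~~ odd b
    then (\sum_(0 <= k < s1.+1) Pstar a (2 * k) * P a ((b %/ 2)%N%:Z - k%:Z)%R)%N
    else (\sum_(0 <= k < s2.+1) Pstar a (2 * k + 1) * P a ((b %/ 2)%N%:Z - k%:Z)%R)%N.
Proof.
move=> s1 s2; case: ifPn => [/negbTE|/negPn] b_odd.
  rewrite (P_sum_Pstar ha (s := s1)).
    by rewrite b_odd; under eq_bigr do rewrite addn0.
  by move=> e _; have := weight_le_sum a e; rewrite /s1; lia.
rewrite (P_sum_Pstar ha (s := s2)) ?b_odd // => e we.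
by have := weight_le_sum a e; rewrite /s2; lia.
Qed.
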